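(* Let $(\mathcal{M},\mathfrak{g})$ be a Riemannian manifold, let $A\subseteq\mathcal{M}$ be a geodesically unique, geodesically convex subset with bounded diameter $\mathrm{diam}(A)$ on which $\mathrm{Exp}$ and $\mathrm{Log}$ are well-defined, and let $f:A\to\mathbb{R}$ be a differentiable $g$-convex function with a minimizer $x^{\star}\in A$. Let $p>1$, $c>0$, let $x_0\in A$, and let $\{x_k\}_{k\ge 0}$ be the iterates, started at $x_0$, of a $p$-descent algorithm with respect to $f$ with descent constant $c$ (either $p$-forward descent or $p$-backward descent). Assume that all iterates $x_k$ lie in $A$. Then there is a constant $C_p$, independent of $k$ and dependent on $p$ and $c$, such that $$f(x_k)-f(x^{\star})\le C_p\,\frac{\mathrm{diam}(A)^p}{k^{p-1}}\qquad\text{for all } k\ge 1 .$$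
   Context: For $x\in\mathcal{M}$, $\langle\cdot,\cdot\rangle_x$ and $\|\cdot\|_x$ are the Riemannian inner product and induced norm on the tangent space $\mathcal{T}_x\mathcal{M}$; $\mathrm{grad} f(x)\in \mathcal{T}_x\mathcal{M}$ is the Riemannian gradient; $d$ is the Riemannian distance; $\mathrm{Exp}_x$ is the exponential map and $\mathrm{Log}_x$ its inverse. A set $A\subseteq\mathcal{M}$ is geodesically unique if any two of its points are connected by a unique geodesic, and geodesically convex if any two of its points are joined by a geodesic whose image lies in $A$. $\mathrm{diam}(A)=\sup_{x,y\in A}d(x,y)$. A function $f:A\to\mathbb{R}$ on a geodesically convex set $A$ is $g$-convex if for all $x,y\in A$ and the geodesic $\gamma_x^y:[0,1]\to A$ from $x$ to $y$, $f(\gamma_x^y(t))\le(1-t)f(x)+tf(y)$ for all $t\in[0,1]$; for differentiable $f$ this is equivalent to $f(\mathrm{Exp}_x(s))\ge f(x)+\langle\mathrm{grad} f(x),s\rangle_x$ whenever $\mathrm{Exp}_x(s)$ is defined. An iterative algorithm with iterates $\{x_k\}$ is, with respect to $f$ and with a constant $c>0$ independent of $k$: - a $p$-forward descent algorithm if $f(x_{k+1})\le f(x_k)-c\,\|\mathrm{grad} f(x_{k+1})\|_{x_{k+1}}^{p/(p-1)}$ for all $k\ge0$; - a $p$-backward descent algorithm if $f(x_{k+1})\le f(x_k)-c\,\|\mathrm{grad} f(x_{k})\|_{x_{k}}^{p/(p-1)}$ for all $k\ge0$.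
   Formalization: For forward descent no constant depending on p and c alone exists, so there C_p may also depend on (f(x_0)-f(x* ))/diam(A)^p; for backward descent it depends only on p and c. Geodesics joining points of A are taken to be minimizing. *)

(* Defs.v *)
From HB Require Import structures.
From mathcomp Require Import all_boot all_order all_algebra.
From mathcomp Require Import all_classical all_reals all_analysis.
Set Implicit Arguments.
Unset Strict Implicit.
Unset Printing Implicit Defensive.
Import Order.TTheory GRing.Theory Num.Theory.
Import numFieldNormedType.Exports.
Local Open Scope classical_set_scope.
Local Open Scope ring_scope.

(* C^k on an open set U of a finite-dimensional space: all iterated directional
   derivatives of order at most k exist and are continuous on U. *)
Fixpoint Ck_on (R : realType) (V W : normedModType R) (k : nat) (U : set V)
    (f : V -> W) : Prop :=
  (forall u, U u -> {for u, continuous f}) /\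
  if k is k'.+1 then
    forall v, (forall u, U u -> derivable f u v) /\ Ck_on k' U ('D_v f)
  else True.

Definition smooth_on (R : realType) (V W : normedModType R) (U : set V)
    (f : V -> W) : Prop := forall k, Ck_on k U f.

(* A chart is a pair of total maps phi, psi of which only the restrictions to
   [cdom i] and to its image matter.  Each point has a preferred chart
   [chart_at x], and the tangent space at x is 'rV[R]_n, a tangent vector being
   identified with its coordinates in that chart. *)
Record smooth_manifold (R : realType) (n : nat) := SmoothManifold {
  carrier :> topologicalType ;
  carrier_hausdorff : hausdorff_space carrier ;
  carrier_second_countable : @second_countable carrier ;
  chart_idx : Type ;
  cdom : chart_idx -> set carrier ;
  phi : chart_idx -> carrier -> 'rV[R]_n ;
  psi : chart_idx -> 'rV[R]_n -> carrier ;
  cdom_open : forall i, open (cdom i) ;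
  phi_image_open : forall i, open (phi i @` cdom i) ;
  phiK : forall i x, cdom i x -> psi i (phi i x) = x ;
  phi_continuous : forall i x, cdom i x -> {for x, continuous (phi i)} ;
  psi_continuous : forall i u,
    (phi i @` cdom i) u -> {for u, continuous (psi i)} ;
  transition_smooth : forall i j,
    smooth_on (phi i @` (cdom i `&` cdom j)) (phi j \o psi i) ;
  chart_at : carrier -> chart_idx ;
  chart_atP : forall x, cdom (chart_at x) x }.

(* The value at psi i u of the constant-coefficient vector field a of the chart
   i, read in the preferred chart of psi i u. *)
Definition coord_field (R : realType) (n : nat) (M : smooth_manifold R n)
    (i : chart_idx M) (u a : 'rV[R]_n) : 'rV[R]_n :=
  'D_a (phi (chart_at (psi i u)) \o psi i) u.

Definition gram_form (R : realType) (n : nat) (G : 'M[R]_n) (u v : 'rV[R]_n) : R :=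
  (u *m G *m v^T) 0 0.

(* [metric x] is the Gram matrix of <.,.>_x in the preferred chart of x. *)
Record riemannian_manifold (R : realType) (n : nat) := RiemannianManifold {
  smooth_part :> smooth_manifold R n ;
  metric : smooth_part -> 'M[R]_n ;
  metric_sym : forall x, (metric x)^T = metric x ;
  metric_pos : forall x v, v != 0 -> 0 < gram_form (metric x) v v ;
  metric_smooth : forall (i : chart_idx smooth_part) (a b : 'rV[R]_n),
    smooth_on (phi i @` cdom i)
      (fun u => gram_form (metric (psi i u)) (coord_field i u a)
                  (coord_field i u b) : R^o) }.

Section Riemannian.
Context (R : realType) (n : nat) (M : riemannian_manifold R n).

Definition inner (x : M) (u v : 'rV[R]_n) : R := gram_form (metric x) u v.

Definition tnorm (x : M) (v : 'rV[R]_n) : R := Num.sqrt (inner x v v).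

(* C^1 curves [0, 1] -> M, given as maps that are C^1 near each t in [0, 1]
   (every C^1 curve on the closed interval extends in this way). *)
Definition C1_curve (g : R -> M) : Prop :=
  forall t, t \in `[0, 1] ->
    {for t, continuous g} /\
    forall i, cdom i (g t) ->
      (\forall s \near t, derivable (phi i \o g) s 1) /\
      {for t, continuous (derive1 (phi i \o g))}.

Definition velocity (g : R -> M) (t : R) : 'rV[R]_n :=
  derive1 (phi (chart_at (g t)) \o g) t.

Definition curve_length (g : R -> M) : \bar R :=
  (\int[lebesgue_measure]_(t in `[0%R, 1%R]) (tnorm (g t) (velocity g t))%:E)%E.

(* [path_length x y L]: some piecewise C^1 path from x to y has length L. *)
Inductive path_length : M -> M -> \bar R -> Prop :=
| path_length_nil x : path_length x x 0%E
| path_length_cons g y L : C1_curve g -> path_length (g 1) y L ->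
    path_length (g 0) y (curve_length g + L)%E.

(* +oo between distinct connected components *)
Definition dist (x y : M) : \bar R := ereal_inf [set L | path_length x y L].

Definition diam (A : set M) : \bar R :=
  ereal_sup [set dist z.1 z.2 | z in A `*` A].

(* Geodesics are the constant-speed curves that are locally of minimal length. *)
Definition geodesic (g : R -> M) : Prop :=
  C1_curve g /\
  exists s : R,
    (forall t, t \in `[0, 1] -> tnorm (g t) (velocity g t) = s) /\
    (forall t, t \in `[0, 1] -> exists2 e : R, 0 < e &
       forall a b, a \in `[0, 1] -> b \in `[0, 1] ->
         `|a - t| < e -> `|b - t| < e ->
         dist (g a) (g b) = (s * `|a - b|)%:E).

Definition geodesic_from_to (g : R -> M) (x y : M) : Prop :=
  [/\ geodesic g, g 0 = x, g 1 = y & curve_length g = dist x y].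

Definition is_Exp (x : M) (v : 'rV[R]_n) (y : M) : Prop :=
  exists g, [/\ geodesic g, g 0 = x, velocity g 0 = v & g 1 = y].

(* Exp_x may be many-to-one; Log_x y is its preimage of length d(x, y). *)
Definition is_Log (x y : M) (v : 'rV[R]_n) : Prop :=
  is_Exp x v y /\ (tnorm x v)%:E = dist x y.

Definition Exp_Log_well_defined (A : set M) : Prop :=
  forall x y, A x -> A y ->
    (exists! v, is_Log x y v) /\
    (forall v, is_Log x y v -> exists! z, is_Exp x v z).

(* Existence and uniqueness of the minimizing geodesic; non-minimizing ones,
   such as the longer arc of a great circle, do not count. *)
Definition geodesically_unique (A : set M) : Prop :=
  forall x y, A x -> A y ->
    (exists g, geodesic_from_to g x y) /\
    (forall g h, geodesic_from_to g x y -> geodesic_from_to h x y ->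
       forall t, t \in `[0, 1] -> g t = h t).

Definition geodesically_convex (A : set M) : Prop :=
  forall x y, A x -> A y ->
    exists2 g, geodesic_from_to g x y & forall t, t \in `[0, 1] -> A (g t).

(* Functions A -> R are total functions whose values off A are never used. *)
Definition g_convex (A : set M) (f : M -> R) : Prop :=
  forall x y g, A x -> A y -> geodesic_from_to g x y ->
    forall t, t \in `[0, 1] -> f (g t) <= (1 - t) * f x + t * f y.

(* f is differentiable at x along A with Riemannian gradient v.  At interior
   points of A this is Frechet differentiability in a chart, and v is unique. *)
Definition is_grad (A : set M) (f : M -> R) (x : M) (v : 'rV[R]_n) : Prop :=
  let ph := phi (chart_at x) in
  let F := within A (nbhs x) in
  (fun y => f y - f x - inner x v (ph y - ph x) : R^o)
    =o_ F (fun y => ph y - ph x).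

Definition forward_descent (p c : R) (f : M -> R) (grad : M -> 'rV[R]_n)
    (x : nat -> M) : Prop :=
  forall k, f (x k.+1) <=
    f (x k) - c * tnorm (x k.+1) (grad (x k.+1)) `^ (p / (p - 1)).

Definition backward_descent (p c : R) (f : M -> R) (grad : M -> 'rV[R]_n)
    (x : nat -> M) : Prop :=
  forall k, f (x k.+1) <=
    f (x k) - c * tnorm (x k) (grad (x k)) `^ (p / (p - 1)).

Record gconvex_setting (A : set M) (f : M -> R) (grad : M -> 'rV[R]_n)
    (xstar : M) (x : nat -> M) : Prop := GConvexSetting {
  setting_unique : geodesically_unique A ;
  setting_convex : geodesically_convex A ;
  setting_diam : (diam A < +oo)%E ;
  setting_Exp_Log : Exp_Log_well_defined A ;
  setting_grad : forall y, A y -> is_grad A f y (grad y) ;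
  setting_gconvex : g_convex A f ;
  setting_xstar : A xstar ;
  setting_min : forall y, A y -> f xstar <= f y ;
  setting_iterates : forall k, A (x k) }.

End Riemannian.

(* Main.v *)
Require Import Defs.
From HB Require Import structures.
From mathcomp Require Import all_boot all_order all_algebra.
From mathcomp Require Import ring lra.
From mathcomp Require Import all_classical all_reals all_analysis.
Set Implicit Arguments.
Unset Strict Implicit.
Unset Printing Implicit Defensive.
Import Order.TTheory GRing.Theory Num.Theory.
Import numFieldNormedType.Exports.
Local Open Scope classical_set_scope.
Local Open Scope ring_scope.

(* Along the minimizing geodesic from x to xstar, convexity bounds the slope of f
   at x by f(xstar) - f(x), so Cauchy-Schwarz gives
   f(x) - f(xstar) <= ||grad f(x)|| diam(A).  A backward descent step therefore
   implies, for h_k = (f(x_k) - f(xstar)) / diam(A)^p, the scale-free recursion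
   h_(k+1) <= h_k - c h_k^(p/(p-1)), under which h_k^(-1/(p-1)) grows at least
   linearly in k.  The implicit recursion of a forward step implies the explicit
   one with a smaller constant depending on h_0. *)

(** * Real powers and scalar descent recursions *)

Lemma le_powRN (R : realType) (a x y : R) :
  0 <= a -> 0 < x -> x <= y -> y `^ (- a) <= x `^ (- a).
Proof.
move=> a0 x0 xy; have y0 : 0 < y by exact: lt_le_trans xy.
rewrite !powRN lef_pV2 ?posrE ?powR_gt0//.
by apply: ge0_ler_powR; rewrite // nnegrE ltW.
Qed.

(** Bernoulli's inequality for a negative exponent: the power is [expR (- a * ln (1 - z))], and
    [ln (1 - z) <= - z] combines with [1 + y <= expR y]. *)
Lemma powRN_ge1Dx (R : realType) (a z : R) :
  0 <= a -> z < 1 -> 1 + a * z <= (1 - z) `^ (- a).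
Proof.
move=> a0 z1; have z0 : 0 < 1 - z by rewrite subr_gt0.
rewrite /powR gt_eqF// mulNr.
apply: le_trans (expR_ge1Dx _).
have /(ler_wpM2l a0) : ln (1 + - z) <= - z by apply: le_ln1Dx; rewrite ltrN2.
by rewrite lerD2l mulrN lerNr.
Qed.

Lemma powR_1D (R : realType) (a x : R) :
  0 < a -> 0 <= x -> x `^ (1 + a) = x * x `^ a.
Proof. by move=> a0 x0; rewrite -(mulr_powRB1 x0) ?addr_gt0// addrC addKr. Qed.

(* In terms of [u = h `^ (- a)] the recursion reads
   [u k.+1 >= u k * (1 - c / u k) `^ (- a) >= u k + a * c]. *)
Lemma power_descent_rate (R : realType) (a c : R) (h : nat -> R) :
  0 < a -> 0 < c -> (forall k, 0 <= h k) ->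
  (forall k, h k.+1 <= h k - c * h k `^ (1 + a)) ->
  forall k, (1 <= k)%N -> h k <= (a * c * k%:R) `^ (- a^-1).
Proof.
move=> a0 c0 h0 hS k k1.
have grow j : 0 < h j -> a * c * j%:R <= h j `^ (- a).
  elim: j => [|j IH] hj1; first by rewrite mulr0 powR_ge0.
  have hp : 0 <= c * h j `^ (1 + a) by rewrite mulr_ge0 ?powR_ge0// ltW.
  have hj : 0 < h j.
    by apply: lt_le_trans hj1 (le_trans (hS j) _); rewrite gerBl.
  have step : h j.+1 <= h j * (1 - c * h j `^ a).
    by apply: le_trans (hS j) _; rewrite powR_1D// mulrBr mulr1 mulrCA.
  (* The product in [step] dominates [h j.+1 > 0], so its second factor is positive. *)
  have z1 : c * h j `^ a < 1.
    by rewrite -subr_gt0 -(pmulr_rgt0 _ hj); exact: lt_le_trans step.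
  apply: le_trans (le_powRN (ltW a0) hj1 step).
  rewrite powRM//; last by rewrite subr_ge0 ltW.
  apply: (@le_trans _ _ (h j `^ (- a) * (1 + a * (c * h j `^ a)))); last first.
    by rewrite ler_wpM2l ?powR_ge0// powRN_ge1Dx// ltW.
  rewrite mulrDr mulr1 -natr1 mulrDr mulr1 lerD ?IH//.
  have ha : h j `^ a != 0 by rewrite gt_eqF// powR_gt0.
  by rewrite powRN [leRHS]mulrC !mulrA mulfK.
have [hk|] := ltP 0 (h k); last by move=> hk; exact: le_trans hk (powR_ge0 _ _).
have ack : 0 < a * c * k%:R by rewrite !mulr_gt0// ltr0n.
have ai : 0 <= a^-1 by rewrite invr_ge0 ltW.
apply: le_trans (le_powRN ai ack (grow k hk)).
by rewrite -powRrM mulrNN mulfV ?gt_eqF// powRr1// ltW.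
Qed.

(* If the step at least halves [h k], then the second term of the minimum
   suffices; otherwise [h k <= 2 * h k.+1] and the first one does. *)
Lemma implicit_descent_explicit (R : realType) (a c : R) (h : nat -> R) :
  0 < a -> 0 < c -> (forall k, 0 <= h k) ->
  (forall k, h k.+1 <= h k - c * h k.+1 `^ (1 + a)) ->
  forall k, h k.+1 <= h k
    - Num.min (c / 2 `^ (1 + a)) (2 * (1 + h 0 `^ a))^-1 * h k `^ (1 + a).
Proof.
move=> a0 c0 h0 hS k.
have h_le0 j : h j <= h 0.
  elim: j => // j; apply: le_trans; apply: le_trans (hS j) _.
  by rewrite gerBl mulr_ge0 ?powR_ge0// ltW.
have [half|half] := leP (h k.+1) (h k / 2).
  have le_min : Num.min (c / 2 `^ (1 + a)) (2 * (1 + h 0 `^ a))^-1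
      * h k `^ (1 + a) <= (2 * (1 + h 0 `^ a))^-1 * h k `^ (1 + a).
    by rewrite ler_wpM2r ?powR_ge0// ge_min lexx orbT.
  (* The left side is [h k / 2] times [h k]^ a / (1 + h 0 [^ a)], a ratio below 1 by monotonicity;
     the [1 +] keeps the denominator positive when [h 0 = 0]. *)
  suff : (2 * (1 + h 0 `^ a))^-1 * h k `^ (1 + a) <= h k / 2 by lra.
  rewrite powR_1D// invfM mulrCA -mulrA ler_wpM2l// ler_piMr//.
  rewrite mulrC ler_pdivrMr ?ltr_pwDl ?powR_ge0// mul1r.
  have : h k `^ a <= h 0 `^ a by apply: ge0_ler_powR; rewrite ?nnegrE// ltW.
  lra.
apply: le_trans (hS k) _; rewrite lerD2l lerN2.
apply: (@le_trans _ _ (c / 2 `^ (1 + a) * h k `^ (1 + a))).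
  by rewrite ler_wpM2r ?powR_ge0// ge_min lexx.
rewrite -mulrA ler_wpM2l ?(ltW c0)// mulrC ler_pdivrMr ?powR_gt0//.
rewrite -powRM//; apply: ge0_ler_powR; rewrite ?nnegrE ?mulr_ge0//; lra.
Qed.

(** * Bounding the optimality gap by gradient norm and diameter *)

Section Geometry.
Context (R : realType) (n : nat) (M : riemannian_manifold R n).
Implicit Types (x y : M) (u v w : 'rV[R]_n).

Lemma innerDl x u v w : inner x (u + v) w = inner x u w + inner x v w.
Proof. by rewrite /inner /gram_form !mulmxDl mxE. Qed.

Lemma innerZl x k u v : inner x (k *: u) v = k * inner x u v.
Proof. by rewrite /inner /gram_form -!scalemxAl mxE. Qed.

Lemma innerC x u v : inner x u v = inner x v u.
Proof.
rewrite /inner /gram_form -[in LHS](Defs.metric_sym x).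
by rewrite -[in LHS](trmxK u) -!trmx_mul mulmxA mxE.
Qed.

Lemma innerZr x k u v : inner x u (k *: v) = k * inner x u v.
Proof. by rewrite innerC innerZl innerC. Qed.

Lemma innerDr x u v w : inner x u (v + w) = inner x u v + inner x u w.
Proof. by rewrite innerC innerDl !(innerC x u). Qed.

Lemma inner0l x u : inner x 0 u = 0.
Proof. by rewrite -(scale0r u) innerZl mul0r. Qed.

Lemma inner_ge0 x u : 0 <= inner x u u.
Proof.
by have [->|/(metric_pos x)/ltW//] := eqVneq u 0; rewrite inner0l.
Qed.

Lemma sqr_tnorm x u : tnorm x u ^+ 2 = inner x u u.
Proof. by rewrite sqr_sqrtr// inner_ge0. Qed.

Lemma inner_Cauchy_Schwarz x u v : `|inner x u v| <= tnorm x u * tnorm x v.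
Proof.
have [->|v0] := eqVneq v 0.
  by rewrite innerC inner0l normr0 mulr_ge0// sqrtr_ge0.
have vv : 0 < inner x v v by exact: metric_pos.
rewrite -ler_sqr ?nnegrE ?mulr_ge0 ?sqrtr_ge0 ?normr_ge0//.
rewrite exprMn !sqr_tnorm real_normK ?num_real//.
(* Division-free residual of projecting [u] onto [v]. *)
have := inner_ge0 x (inner x v v *: u - inner x u v *: v).
rewrite -scaleNr !innerDl !innerDr !innerZl !innerZr (innerC x v u) => H.
suff : 0 <= inner x v v * (inner x u u * inner x v v - inner x u v ^+ 2).
  by rewrite pmulr_rge0// subr_ge0.
by move: H; congr (0 <= _); ring.
Qed.

Lemma inner_continuous x u : continuous (inner x u : 'rV[R]_n -> R).
Proof.
have -> : inner x u = (fun v => \sum_j (u *m Defs.metric x) 0 j * v 0 j).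
  apply/funext => v; rewrite /inner /gram_form mxE.
  by apply: eq_bigr => j _; rewrite [v^T _ _]mxE.
apply: continuous_big => [|j _ v]; first exact: add_continuous.
by apply: continuousM; [exact: cst_continuous|exact: coord_continuous].
Qed.

(** [is_grad] controls [f] only within [A], and a geodesic is known to stay in [A] only for
    parameters in [0, 1]; hence difference quotients are taken from the right. *)
Lemma is_grad_directional_le (A : set M) (f : M -> R) x v (g : R -> M) (l : R) :
  is_grad A f x v -> g 0 = x -> {for 0, continuous g} ->
  derivable (phi (chart_at x) \o g) 0 1 ->
  (\forall t \near 0^'+, A (g t) /\ f (g t) - f x <= t * l) ->
  inner x v (velocity g 0) <= l.
Proof.
move=> fgrad g0 gcont gder fg.
set ph := phi (chart_at x); set w := velocity g 0.
pose q t : 'rV[R]_n := t^-1 *: (ph (g t) - ph x).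
have qw : q t @[t --> 0^'+] --> w.
  apply: cvg_dnbhs_at_right.
  rewrite /w /velocity g0 derive1E /derive -/ph.
  have -> : q = (fun h => h^-1 *: ((ph \o g \o shift 0) (h *: 1) - (ph \o g) 0)).
    by apply/funext => t; rewrite /q /= addr0 /GRing.scale /= mulr1 g0.
  exact: gder.
(* The little-o remainder leaves an error [e *]|w|[in the limit. Rescaling]e[by]1 + [|w|] makes it
   harmless, also when [w = 0]. *)
suff bound (e : R) : 0 < e -> inner x v w <= l + e * `|w|.
  apply/ler_addgt0Pr => e e0.
  have w1 : 0 < 1 + `|w| by rewrite ltr_pwDl.
  apply: le_trans (bound (e / (1 + `|w|)) (divr_gt0 e0 w1)) _.
  rewrite lerD2l mulrAC ler_pdivrMr// ler_wpM2l ?(ltW e0)// lerDr//.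
move=> e0.
have gx : g t @[t --> 0^'+] --> x.
  by rewrite -g0; exact: cvg_at_right_filter.
have fe : \forall t \near 0^'+, A (g t) ->
    `|f (g t) - f x - inner x v (ph (g t) - ph x)| <= e * `|ph (g t) - ph x|.
  have /eqoP/(_ e e0) := fgrad.
  exact: gx.
have : (inner x v (q t) - e * `|q t|) @[t --> 0^'+] --> inner x v w - e * `|w|.
  apply: cvgB; first exact: (cvg_comp _ _ qw (@inner_continuous x v w)).
  by apply: cvgM; [exact: cvg_cst|exact: cvg_norm].
move/cvgr_to_le => /(_ l); rewrite lerBlDr; apply.
near=> t.
have t0 : 0 < t by near: t; exact: nbhs_right_gt.
have [At ft] : A (g t) /\ f (g t) - f x <= t * l by near: t.
have : `|f (g t) - f x - inner x v (ph (g t) - ph x)| <= e * `|ph (g t) - ph x|.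
  by move: At; near: t.
rewrite ler_norml => /andP[+ _] => ge.
rewrite innerZr normrZ gtr0_norm ?invr_gt0// mulrCA -mulrBr.
rewrite mulrC ler_pdivrMr// (mulrC l); lra.
Unshelve. all: by end_near. Qed.

Lemma curve_length_const_speed (g : R -> M) (s : R) :
  (forall t, t \in `[0, 1] -> tnorm (g t) (velocity g t) = s) ->
  curve_length g = s%:E.
Proof.
move=> gs; rewrite /curve_length.
rewrite (@eq_integral _ _ _ _ _ (cst s%:E)); last first.
  by move=> t; rewrite inE /= => /gs ->.
by rewrite integral_cst//= lebesgue_measure_itv/= lte_fin ltr01 oppr0 adde0 mule1.
Qed.

Lemma dist_le_diam (A : set M) x y : A x -> A y -> (dist x y <= diam A)%E.
Proof. by move=> Ax Ay; apply: ereal_sup_ubound; exists (x, y). Qed.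

Lemma gconvex_gap_le (A : set M) (f : M -> R) (grad : M -> 'rV[R]_n) xstar
    (xs : nat -> M) :
  gconvex_setting A f grad xstar xs -> forall x, A x ->
  f x - f xstar <= tnorm x (grad x) * fine (diam A).
Proof.
case=> _ Aconv Adiam _ fgrad fconv Astar _ _ x Ax.
have [g gxy gA] := Aconv _ _ Ax Astar.
have [[gC1 [s [gs _]]] g0 g1 glen] := gxy.
have in0 : (0 : R) \in `[0, 1] by rewrite in_itv /= lexx ler01.
have [gcont /(_ (chart_at x))] := gC1 _ in0.
rewrite g0 => /(_ (chart_atP x)) [/nbhs_singleton gder _].
(* Convexity along [g] bounds [f (g t) - f x] by [t * (f xstar - f x)]. *)
have slope : inner x (grad x) (velocity g 0) <= f xstar - f x.
  apply: (is_grad_directional_le (fgrad _ Ax) g0 gcont gder).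
  near=> t.
  have t01 : t \in `[0, 1].
    by rewrite in_itv /=; apply/andP; split; near: t;
      [exact: nbhs_right_ge|exact: nbhs_right_le].
  split; first exact: gA.
  have := fconv _ _ _ Ax Astar gxy _ t01; lra.
(* Constant speed over a unit interval makes [s] the length of [g], which is the distance from [x]
   to [xstar] since [g] is minimizing. *)
have s_diam : s <= fine (diam A).
  have := dist_le_diam Ax Astar.
  rewrite -glen (curve_length_const_speed gs).
  by move: Adiam; case: (diam A) => //= r _; rewrite lee_fin.
have := inner_Cauchy_Schwarz x (grad x) (velocity g 0).
have := gs _ in0; rewrite g0 => ->.
rewrite ler_norml => /andP[CS _].
have := ler_wpM2l (sqrtr_ge0 (inner x (grad x) (grad x))) s_diam.
rewrite -/(tnorm x (grad x)); lra.
Unshelve. all: by end_near. Qed.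

End Geometry.

(* The exponents satisfy [q = p / (p - 1)], hence [(D `^ (p - 1)) `^ q = D `^ p]. *)
Lemma scaled_gap_powR_le (R : realType) (p D e G : R) : 1 < p -> 0 < D ->
  0 <= e -> 0 <= G -> e <= G * D ->
  (e / D `^ p) `^ (p / (p - 1)) <= G `^ (p / (p - 1)) / D `^ p.
Proof.
move=> p1 D0 e0 G0 eGD; have Dp : 0 < D `^ (p - 1) by rewrite powR_gt0.
have p10 : 0 < p - 1 by rewrite subr_gt0.
have q0 : 0 <= p / (p - 1) by rewrite divr_ge0 ?(ltW p10)//; lra.
have DpE : D `^ p = D * D `^ (p - 1) by rewrite mulr_powRB1 ?ltW//; lra.
have Dq : (D `^ (p - 1)) `^ (p / (p - 1)) = D `^ p.
  by rewrite -powRrM mulrC divfK// gt_eqF.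
rewrite ler_pdivlMr ?powR_gt0// -{2}Dq -powRM ?divr_ge0 ?powR_ge0//.
apply: ge0_ler_powR => //; rewrite ?nnegrE ?mulr_ge0 ?invr_ge0 ?powR_ge0//.
by rewrite DpE invfM mulrA -mulrA mulVf ?gt_eqF// mulr1 ler_pdivrMr.
Qed.

(** * Convergence rates for backward and forward descent *)

Section Rates.
Context (R : realType) (p c : R) (p_gt1 : 1 < p) (c_gt0 : 0 < c).
Context (n : nat) (M : riemannian_manifold R n) (A : set M) (f : M -> R).
Context (grad : M -> 'rV[R]_n) (xstar : M) (x : nat -> M).
Context (setting : gconvex_setting A f grad xstar x).

Let D := fine (diam A).
Let h k := (f (x k) - f xstar) / D `^ p.
Let q := p / (p - 1).
Let G k := tnorm (x k) (grad (x k)).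

Let p1_gt0 : 0 < p - 1. Proof. by rewrite subr_gt0. Qed.

Let qE : q = 1 + (p - 1)^-1.
Proof. by rewrite /q; field; rewrite gt_eqF. Qed.

Let gap_ge0 k : 0 <= f (x k) - f xstar.
Proof.
by rewrite subr_ge0; apply: (setting_min setting); exact: (setting_iterates setting).
Qed.

Let h_ge0 k : 0 <= h k. Proof. by rewrite divr_ge0 ?powR_ge0. Qed.

Let gap_le k : f (x k) - f xstar <= G k * D.
Proof. by apply: (gconvex_gap_le setting); exact: (setting_iterates setting). Qed.

(** The index [j] of the gradient is left free to serve both schemes: [j = k] for backward steps,
    [j = k.+1] for forward ones. *)
Let h_descent k j : 0 < D -> f (x k.+1) <= f (x k) - c * G j `^ q ->
  h k.+1 <= h k - c * h j `^ (1 + (p - 1)^-1).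
Proof.
move=> D0 fk; have Dp : 0 < D `^ p by rewrite powR_gt0.
apply: (@le_trans _ _ (h k - c * (G j `^ q / D `^ p))); last first.
  rewrite lerD2l lerN2 -qE ler_wpM2l ?(ltW c_gt0)//.
  by apply: scaled_gap_powR_le; rewrite ?sqrtr_ge0.
rewrite /h mulrA -mulrBl ler_wpM2r ?invr_ge0 ?(ltW Dp)//; lra.
Qed.

Lemma gap_rate (c' : R) : 0 < c' ->
  (0 < D -> forall k, h k.+1 <= h k - c' * h k `^ (1 + (p - 1)^-1)) ->
  forall k, (1 <= k)%N -> f (x k) - f xstar <=
    ((p - 1)^-1 * c') `^ (- (p - 1)) * (D `^ p / k%:R `^ (p - 1)).
Proof.
move=> c'0 hS k k1; have [D0|D0] := ltP 0 D; last first.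
  apply: le_trans (gap_le k) _; apply: (@le_trans _ _ 0).
    by rewrite mulr_ge0_le0// sqrtr_ge0.
  by rewrite mulr_ge0 ?divr_ge0 ?powR_ge0.
have a0 : 0 < (p - 1)^-1 by rewrite invr_gt0.
have := power_descent_rate a0 c'0 h_ge0 (hS D0) k1.
rewrite invrK powRM ?mulr_ge0 ?(ltW a0) ?(ltW c'0)// (powRN k%:R) /h.
rewrite ler_pdivrMr ?powR_gt0// => /le_trans; apply.
by rewrite mulrAC mulrA.
Qed.

Lemma backward_rate : backward_descent p c f grad x ->
  forall k, (1 <= k)%N -> f (x k) - f xstar <=
    ((p - 1)^-1 * c) `^ (- (p - 1)) * (D `^ p / k%:R `^ (p - 1)).
Proof. by move=> desc; apply: gap_rate => // D0 k; exact: h_descent. Qed.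

(** The constant of [implicit_descent_explicit] at [a = (p - 1)^-1]; [r] stands for the scaled
    initial gap, its only dependence on the problem beyond [p] and [c]. *)
Definition implicit_const (r : R) : R :=
  Num.min (c / 2 `^ (1 + (p - 1)^-1)) (2 * (1 + r `^ (p - 1)^-1))^-1.

Lemma forward_rate : forward_descent p c f grad x ->
  forall k, (1 <= k)%N -> f (x k) - f xstar <=
    ((p - 1)^-1 * implicit_const (h 0)) `^ (- (p - 1))
      * (D `^ p / k%:R `^ (p - 1)).
Proof.
move=> desc; apply: gap_rate => [|D0 k].
  rewrite /implicit_const lt_min divr_gt0 ?powR_gt0//=.
  by rewrite invr_gt0 mulr_gt0// ltr_pwDl ?powR_ge0.
apply: implicit_descent_explicit; rewrite ?invr_gt0// => j.
exact: h_descent.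
Qed.

End Rates.

Theorem theorem2 (R : realType) (p c : R) (p_gt1 : 1 < p) (c_gt0 : 0 < c) :
  (exists C : R,
     forall (n : nat) (M : riemannian_manifold R n) (A : set M) (f : M -> R)
       (grad : M -> 'rV[R]_n) (xstar : M) (x : nat -> M),
     gconvex_setting A f grad xstar x ->
     backward_descent p c f grad x ->
     forall k : nat, (1 <= k)%N ->
       f (x k) - f xstar <= C * (fine (diam A) `^ p / k%:R `^ (p - 1)))
  /\
  (exists C : R -> R,
     forall (n : nat) (M : riemannian_manifold R n) (A : set M) (f : M -> R)
       (grad : M -> 'rV[R]_n) (xstar : M) (x : nat -> M),
     gconvex_setting A f grad xstar x ->
     forward_descent p c f grad x ->
     forall k : nat, (1 <= k)%N ->
       f (x k) - f xstar <=
         C ((f (x 0) - f xstar) / fine (diam A) `^ p)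
           * (fine (diam A) `^ p / k%:R `^ (p - 1))).
Proof.
split.
  exists (((p - 1)^-1 * c) `^ (- (p - 1))) => n M A f grad xstar x setting desc.
  exact: (backward_rate p_gt1 c_gt0 setting desc).
exists (fun r => ((p - 1)^-1 * implicit_const p c r) `^ (- (p - 1))).
move=> n M A f grad xstar x setting desc.
exact: (forward_rate p_gt1 c_gt0 setting desc).
Qed.
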